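(* If $G$ and $H$ are graphs, then $$\begin{aligned}M(G\vee H;x,y)={}&\sum_{i\le i'}\ \sum_{j,j'} m_{i,i'}(G)\,n_j(H)\,n_{j'}(H)\,x^{\min\{\delta_\vee(i,j),\,\delta_\vee(i',j')\}}\,y^{\max\{\delta_\vee(i,j),\,\delta_\vee(i',j')\}}\\&+\sum_{j\le j'}\ \sum_{i,i'} m_{j,j'}(H)\,n_i(G)\,n_{i'}(G)\,x^{\min\{\delta_\vee(i,j),\,\delta_\vee(i',j')\}}\,y^{\max\{\delta_\vee(i,j),\,\delta_\vee(i',j')\}}\\&-\sum_{i\le i'}\ \sum_{j\le j'} m_{i,i'}(G)\,m_{j,j'}(H)\Bigl(x^{\min\{\delta_\vee(i,j),\,\delta_\vee(i',j')\}}\,y^{\max\{\delta_\vee(i,j),\,\delta_\vee(i',j')\}}\\&\qquad\qquad+x^{\min\{\delta_\vee(i,j'),\,\delta_\vee(i',j)\}}\,y^{\max\{\delta_\vee(i,j'),\,\delta_\vee(i',j)\}}\Bigr),\end{aligned}$$ where $\delta_\vee(i,j)=i\,n_H+j\,n_G-ij$.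
   Context: All graphs are finite, simple, and undirected; $n_G=|V(G)|$ and $\deg_G(g)$ is the degree of $g\in V(G)$. For $i\ge 0$ let $n_i(G)=|\{g\in V(G): \deg_G(g)=i\}|$, and for $i\le j$ let $m_{i,j}(G)=|\{\{g,g'\}\in E(G): \{\deg_G(g),\deg_G(g')\}=\{i,j\}\}|$. The M-polynomial of $G$ is $M(G;x,y)=\sum_{i\le j} m_{i,j}(G)\,x^iy^j$. The disjunction product $G\vee H$ has vertex set $V(G)\times V(H)$; vertices $(g_1,h_1)$ and $(g_2,h_2)$ are adjacent if $g_1g_2\in E(G)$ or $h_1h_2\in E(H)$ (or both). The quantity $\delta_\vee(i,j)$ is the degree in $G\vee H$ of any vertex $(g,h)$ with $\deg_G(g)=i$, $\deg_H(h)=j$. Indices $i,i'$ range over vertex degrees of $G$ and $j,j'$ over vertex degrees of $H$; the sums over $j,j'$ (resp. $i,i'$) without an inequality are over all ordered pairs. *)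

(* Defs.v *)
From HB Require Import structures.
From mathcomp Require Import all_boot all_order all_algebra.
From mathcomp Require Import mpoly.
Set Implicit Arguments.
Unset Strict Implicit.
Unset Printing Implicit Defensive.
Import GRing.Theory.

Record sgraph := SGraph {
  vertex :> finType;
  adj : rel vertex;
  adj_sym : ssrbool.symmetric adj;
  adj_irr : irreflexive adj }.

Definition deg (G : sgraph) (g : G) : nat := #|[set g' | adj g g']|.

Definition degrees (G : sgraph) : seq nat := undup [seq deg g | g : G].

Definition n_ (G : sgraph) (i : nat) : nat := #|[set g : G | deg g == i]|.

(* Edges are counted as unordered pairs; perm_eq compares the two degrees with
   {i, j} as multisets. *)
Definition m_ (G : sgraph) (i j : nat) : nat :=
  #|[set [set g; g'] | g in G, g' in G
       & adj g g' && perm_eq [:: deg g; deg g'] [:: i; j]]|.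

Notation x_ := ('X_(Ordinal (isT : 0 < 2)) : {mpoly int[2]}).
Notation y_ := ('X_(Ordinal (isT : 1 < 2)) : {mpoly int[2]}).

(* Restricting the sum to i, j that occur as degrees makes it finite and loses
   nothing, since m_ G i j = 0 otherwise. *)
Definition M_poly (G : sgraph) : {mpoly int[2]} :=
  (\sum_(i <- degrees G) \sum_(j <- degrees G | (i <= j)%N)
     (m_ G i j)%:R * (x_ ^+ i * y_ ^+ j))%R.

Section DisjunctionProduct.
Variables G H : sgraph.

Definition disj_adj : rel (G * H) :=
  fun u v => adj u.1 v.1 || adj u.2 v.2.

Lemma disj_adj_sym : ssrbool.symmetric disj_adj.
Proof. by move=> u v; rewrite /disj_adj adj_sym (adj_sym u.2). Qed.

Lemma disj_adj_irr : irreflexive disj_adj.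
Proof. by move=> u; rewrite /disj_adj !adj_irr. Qed.

Definition disj_prod : sgraph := SGraph disj_adj_sym disj_adj_irr.

(* The truncated subtraction is exact when i <= #|G| or j <= #|H|, hence
   whenever i and j are vertex degrees. *)
Definition delta_disj (i j : nat) : nat := i * #|H| + j * #|G| - i * j.

End DisjunctionProduct.

(* Main.v *)
(* Replacing each edge by its two orientations, twice a sum over edges weighted
   by a symmetric function of the end degrees becomes a sum over ordered pairs
   of adjacent vertices.  In these terms the identity is inclusion-exclusion for
   the adjacency [adj g g' || adj h h'] of the product.  In the subtracted
   part both factors carry unordered edges, hence a factor 4; it is balanced by
   the two monomials there, which become equal after exchanging h and h'. *)
Require Import Defs.
From HB Require Import structures.
From mathcomp Require Import all_boot all_order all_algebra.
From mathcomp Require Import mpoly.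
Set Implicit Arguments.
Unset Strict Implicit.
Unset Printing Implicit Defensive.
Import GRing.Theory.
Local Open Scope ring_scope.

Lemma mem_degrees (G : sgraph) (g : G) : deg g \in degrees G.
Proof. by rewrite mem_undup; apply: image_f. Qed.

Lemma uniq_degrees (G : sgraph) : uniq (degrees G).
Proof. exact: undup_uniq. Qed.

Lemma big_uniq_pred1 (V : nmodType) (I : eqType) (r : seq I) (k : I) (F : I -> V) :
  uniq r -> k \in r -> \sum_(i <- r | i == k) F i = F k.
Proof.
move=> r_uniq k_r; rewrite -big_filter filter_pred1_uniq //.
by rewrite big_seq1.
Qed.

(** Grouping the vertices by degree; this removes the factors [n_] from the first two sums of the
    theorem. *)
Lemma sum_n_ (R : pzSemiRingType) (G : sgraph) (F : nat -> R) :
  \sum_(i <- degrees G) (n_ G i)%:R * F i = \sum_(g : G) F (deg g).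
Proof.
transitivity (\sum_(i <- degrees G) \sum_(g : G | i == deg g) F i).
  apply: eq_bigr => i _; rewrite sumr_const mulr_natl; congr (_ *+ _).
  by apply: eq_card => g; rewrite !inE eq_sym.
rewrite (exchange_big_dep xpredT) //=; apply: eq_bigr => g _.
by rewrite big_uniq_pred1 ?uniq_degrees ?mem_degrees.
Qed.

Lemma set2_eq (T : finType) (a b c d : T) :
  ([set a; b] == [set c; d]) = ((a, b) == (c, d)) || ((a, b) == (d, c)).
Proof.
apply/eqP/orP => [eq_ab|[] /eqP[-> ->] //]; last exact: setUC.
have : a \in [set c; d] by rewrite -eq_ab set21.
have : b \in [set c; d] by rewrite -eq_ab set22.
have : c \in [set a; b] by rewrite eq_ab set21.
have : d \in [set a; b] by rewrite eq_ab set22.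
rewrite !inE !xpair_eqE.
by case: (eqVneq a c); case: (eqVneq a d); case: (eqVneq b c);
  case: (eqVneq b d); auto.
Qed.

(** The map from ordered pairs to edges has fibres of size exactly two: an edge comes from [(g, g')]
    and [(g', g)], which differ because [adj] is irreflexive. *)
Lemma double_m_ (G : sgraph) (i j : nat) :
  (m_ G i j).*2 =
    #|[set p : G * G | adj p.1 p.2 & perm_eq [:: deg p.1; deg p.2] [:: i; j]]|.
Proof.
set P := [set p | _ & _]; pose e (p : G * G) := [set p.1; p.2].
have -> : m_ G i j = #|e @: P|.
  apply: eq_card => A; apply/imset2P/imsetP => [[g g' _]|[[g g']]].
    by rewrite inE => /andP[_ Pgg'] ->; exists (g, g'); rewrite ?inE.
  rewrite inE => Pgg' ->; exists g g' => //.
  by rewrite inE.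
rewrite -[RHS]sum1_card (partition_big_imset e) /= -muln2 -sum_nat_const.
apply: eq_bigr => _ /imsetP[[g g'] + ->]; rewrite inE /= => /andP[adj_gg' eq_ij].
rewrite sum1dep_card -(_ : #|[set (g, g'); (g', g)]| = 2%N).
  apply: eq_card => -[h h']; rewrite !inE /e /= set2_eq.
  apply/orP/andP => [[] /eqP[-> ->]|[_ /orP//]].
    by rewrite adj_gg' eq_ij eqxx.
  by rewrite adj_sym adj_gg' (perm_catC [:: deg g'] [:: deg g]) eq_ij eqxx orbT.
rewrite cards2 xpair_eqE; case: eqP => // eq_gg'.
by rewrite eq_gg' adj_irr in adj_gg'.
Qed.

(** Ensures that an oriented edge is counted at exactly one index pair of a sum restricted to
    [i <= j]. *)
Lemma perm_eq_pair_le (a b i j : nat) :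
  (i <= j)%N && perm_eq [:: a; b] [:: i; j] = (i == minn a b) && (j == maxn a b).
Proof.
apply/andP/andP => [[le_ij eq_ij]|[/eqP-> /eqP->]].
  have : a \in [:: i; j] by rewrite -(perm_mem eq_ij) mem_head.
  rewrite !inE => /orP[] /eqP eq_a; move: eq_ij; rewrite eq_a.
    rewrite perm_cons => /perm_small_eq-/(_ isT)[->].
    by rewrite (minn_idPl le_ij) (maxn_idPr le_ij) !eqxx.
  rewrite perm_sym (perm_catC [:: i] [:: j]) perm_cons => /perm_small_eq-/(_ isT)[<-].
  by rewrite (minn_idPr le_ij) (maxn_idPl le_ij) !eqxx.
case: (leqP a b) => [le_ab|/ltnW le_ba]; split=> //.
by rewrite (perm_catC [:: a] [:: b]).
Qed.

(** Each oriented edge contributes at one index pair only, the minimum and maximum of its end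
    degrees, and symmetry of [F] makes the value there independent of the orientation. *)
Lemma sum_m_ (R : pzSemiRingType) (G : sgraph) (F : nat -> nat -> R) :
  (forall i j, F i j = F j i) ->
  (\sum_(i <- degrees G) \sum_(j <- degrees G | (i <= j)%N) (m_ G i j)%:R * F i j)
    *+ 2 = \sum_(g : G) \sum_(g' : G | adj g g') F (deg g) (deg g').
Proof.
move=> F_sym; rewrite -sumrMnl.
transitivity (\sum_(i <- degrees G) \sum_(j <- degrees G | (i <= j)%N)
  \sum_(p : G * G | adj p.1 p.2 && perm_eq [:: deg p.1; deg p.2] [:: i; j]) F i j).
  apply: eq_bigr => i _; rewrite -sumrMnl; apply: eq_bigr => j _.
  rewrite -mulrnAl -mulrnA muln2 double_m_ sumr_const mulr_natl.
  by congr (_ *+ _); apply: eq_card => p; rewrite !inE.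
rewrite pair_big_dep /=.
transitivity (\sum_(p : G * G | adj p.1 p.2)
  \sum_(i <- degrees G | i == minn (deg p.1) (deg p.2))
  \sum_(j <- degrees G | j == maxn (deg p.1) (deg p.2)) F i j).
  rewrite [RHS](exchange_big_dep xpredT) //=; apply: eq_bigr => i _.
  rewrite [LHS](exchange_big_dep (fun p => adj p.1 p.2)) /=; last first.
    by move=> j p _ /andP[].
  (* For fixed [i], the oriented edges whose smaller end degree is not [i] meet no admissible [j],
     so their part vanishes. *)
  rewrite [LHS](bigID (fun p => i == minn (deg p.1) (deg p.2))) /=.
  rewrite [X in _ + X]big1 ?addr0 => [|p /andP[adj_p ne_i]].
    apply: eq_bigr => p /andP[adj_p eq_i]; apply: eq_bigl => j.
    by rewrite adj_p /= perm_eq_pair_le eq_i.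
  by rewrite big1 // => j; rewrite adj_p /= perm_eq_pair_le (negPf ne_i).
apply: eq_bigr => -[g g'] _ /=.
rewrite !big_uniq_pred1 ?uniq_degrees //.
- by case: leqP.
- by case: leqP => _; rewrite mem_degrees.
- by case: leqP => _; rewrite mem_degrees.
Qed.

Lemma sum_rel_prod (V : nmodType) (S T : finType) (P : rel S) (Q : rel T)
    (F : S * T -> S * T -> V) :
  \sum_(s : S) \sum_(s' | P s s') \sum_(t : T) \sum_(t' | Q t t') F (s, t) (s', t') =
  \sum_u \sum_(v | P u.1 v.1 && Q u.2 v.2) F u v.
Proof.
under eq_bigr do rewrite exchange_big.
rewrite pair_bigA; apply: eq_bigr => -[s t] _ /=.
by rewrite pair_big_dep; apply: eq_bigr => -[].
Qed.

Lemma sum_orb (V : zmodType) (I : finType) (P Q : pred I) (F : I -> V) :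
  \sum_(i | P i || Q i) F i =
  \sum_(i | P i) F i + \sum_(i | Q i) F i - \sum_(i | P i && Q i) F i.
Proof.
rewrite (bigID P) (bigID P Q) /= [X in _ + (X + _)](eq_bigl _ _ (fun i => andbC _ _)).
rewrite [X in _ + X - _]addrC addrA addrK; congr (_ + _); apply: eq_bigl => i;
by case: (P i); case: (Q i).
Qed.

(** The neighbourhood of [(g, h)] is the union of N(g) x V(H) and V(G) x N(h), which intersect in
    N(g) x N(h). *)
Lemma deg_disj_prod (G H : sgraph) (g : G) (h : H) :
  deg ((g, h) : disj_prod G H) = delta_disj G H (deg g) (deg h).
Proof.
pose A := setX [set g' | adj g g'] [set: H].
pose B := setX [set: G] [set h' | adj h h'].
have -> : deg ((g, h) : disj_prod G H) = #|A :|: B|.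
  by apply: eq_card => -[g' h']; rewrite !inE andbT.
have AB : A :&: B = setX [set g' | adj g g'] [set h' | adj h h'].
  by apply/setP => -[g' h']; rewrite !inE andbT.
rewrite cardsU AB !cardsX !cardsT.
by rewrite /delta_disj [(#|G| * _)%N]mulnC.
Qed.

(** Lets the identity be proved after doubling; cancellation holds coefficientwise in [int]. *)
Lemma mulrn_mpoly_int_inj (n k : nat) :
  (0 < k)%N -> injective (fun p : {mpoly int[n]} => p *+ k).
Proof.
move=> k_gt0 p q /= eq_pq; apply/mpolyP => m.
apply: (Num.Theory.pmulrnI k_gt0).
by rewrite /= -!mcoeffMn eq_pq.
Qed.

Theorem theorem3p9 (G H : sgraph) :
  let d := delta_disj G H in
  (forall (g : G) (h : H),
      deg ((g, h) : disj_prod G H) = d (deg g) (deg h)) /\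
  M_poly (disj_prod G H) =
    \sum_(i <- degrees G) \sum_(i' <- degrees G | (i <= i')%N)
      \sum_(j <- degrees H) \sum_(j' <- degrees H)
        (m_ G i i')%:R * (n_ H j)%:R * (n_ H j')%:R
        * (x_ ^+ minn (d i j) (d i' j') * y_ ^+ maxn (d i j) (d i' j'))
  + \sum_(j <- degrees H) \sum_(j' <- degrees H | (j <= j')%N)
      \sum_(i <- degrees G) \sum_(i' <- degrees G)
        (m_ H j j')%:R * (n_ G i)%:R * (n_ G i')%:R
        * (x_ ^+ minn (d i j) (d i' j') * y_ ^+ maxn (d i j) (d i' j'))
  - \sum_(i <- degrees G) \sum_(i' <- degrees G | (i <= i')%N)
      \sum_(j <- degrees H) \sum_(j' <- degrees H | (j <= j')%N)
        (m_ G i i')%:R * (m_ H j j')%:R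
        * (x_ ^+ minn (d i j) (d i' j') * y_ ^+ maxn (d i j) (d i' j')
           + x_ ^+ minn (d i j') (d i' j) * y_ ^+ maxn (d i j') (d i' j)).
Proof.
move=> d; split; first exact: deg_disj_prod.
(* Taking the minimum and maximum makes the monomial symmetric, so that [sum_m_] applies; for
   [a <= b] it is just [x_ ^+ a * y_ ^+ b]. *)
pose F a b : {mpoly int[2]} := x_ ^+ minn a b * y_ ^+ maxn a b.
have F_sym a b : F a b = F b a by rewrite /F minnC maxnC.
pose E (u v : disj_prod G H) := F (deg u) (deg v).
have E_deg g h g' h' :
    E (g, h) (g', h') = F (d (deg g) (deg h)) (d (deg g') (deg h')).
  by rewrite /E !deg_disj_prod.
set S1 := (X in X + _ - _); set S2 := (X in _ + X - _); set S3 := (X in _ - X).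
have S1_2 : S1 *+ 2 = \sum_u \sum_(v | adj u.1 v.1) E u v.
  (* The contribution of all ordered pairs from [H] to an edge of [G] with end degrees [i], [i'];
     exchanging [h] and [h'] shows that it is symmetric. *)
  pose f i i' := \sum_(h : H) \sum_(h' : H) F (d i (deg h)) (d i' (deg h')).
  have f_sym i i' : f i i' = f i' i.
    by rewrite /f exchange_big; do 2!apply: eq_bigr => ? _.
  have -> : S1 = \sum_(i <- degrees G) \sum_(i' <- degrees G | (i <= i')%N)
      (m_ G i i')%:R * f i i'.
    apply: eq_bigr => i _; apply: eq_bigr => i' _.
    rewrite /f -(sum_n_ H (fun j => \sum_h' F (d i j) (d i' (deg h')))) mulr_sumr.
    apply: eq_bigr => j _.
    rewrite -(sum_n_ H (fun j' => F (d i j) (d i' j'))) 2!mulr_sumr.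
    apply: eq_bigr => j' _.
    by rewrite -!mulrA.
  rewrite sum_m_ //.
  transitivity (\sum_(g : G) \sum_(g' | adj g g') \sum_(h : H) \sum_(h' : H)
      E (g, h) (g', h')).
    by do 4!apply: eq_bigr => ? _; rewrite E_deg.
  rewrite (sum_rel_prod (@adj G) (fun _ _ : H => true)).
  by apply: eq_bigr => u _; apply: eq_bigl => v; rewrite andbT.
have S2_2 : S2 *+ 2 = \sum_u \sum_(v | adj u.2 v.2) E u v.
  pose f j j' := \sum_(g : G) \sum_(g' : G) F (d (deg g) j) (d (deg g') j').
  have f_sym j j' : f j j' = f j' j.
    by rewrite /f exchange_big; do 2!apply: eq_bigr => ? _.
  have -> : S2 = \sum_(j <- degrees H) \sum_(j' <- degrees H | (j <= j')%N)
      (m_ H j j')%:R * f j j'.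
    apply: eq_bigr => j _; apply: eq_bigr => j' _.
    rewrite /f -(sum_n_ G (fun i => \sum_g' F (d i j) (d (deg g') j'))) mulr_sumr.
    apply: eq_bigr => i _.
    rewrite -(sum_n_ G (fun i' => F (d i j) (d i' j'))) 2!mulr_sumr.
    apply: eq_bigr => i' _.
    by rewrite -!mulrA.
  rewrite sum_m_ //.
  transitivity (\sum_(g : G) \sum_(g' : G) \sum_(h : H) \sum_(h' | adj h h')
      E (g, h) (g', h')).
    (* Here the edges of [H] are summed outermost; the pairs from [G] are moved outside to fit
       [sum_rel_prod]. *)
    rewrite pair_big_dep pair_bigA /f.
    under eq_bigr do rewrite pair_bigA.
    rewrite exchange_big; apply: eq_bigr => p _.
    by rewrite pair_big_dep; apply: eq_bigr => q _; rewrite E_deg.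
  exact: (sum_rel_prod (fun _ _ : G => true)).
have S3_2 : S3 *+ 2 = \sum_u \sum_(v | adj u.1 v.1 && adj u.2 v.2) E u v.
  apply: (@mulrn_mpoly_int_inj _ 2) => //=.
  (* One monomial alone is invariant only under exchanging both index pairs at once; the sum of the
     two is symmetric in each pair separately, as both uses of [sum_m_] require. *)
  pose q i i' j j' := F (d i j) (d i' j') + F (d i j') (d i' j).
  pose f i i' := \sum_(h : H) \sum_(h' | adj h h') q i i' (deg h) (deg h').
  have q_symG i i' j j' : q i i' j j' = q i' i j j'.
    by rewrite /q addrC; congr (_ + _).
  have q_symH i i' j j' : q i i' j j' = q i i' j' j by rewrite /q addrC.
  have f_sym i i' : f i i' = f i' i by do 2!apply: eq_bigr => ? _.
  have -> : S3 *+ 2 = \sum_(i <- degrees G) \sum_(i' <- degrees G | (i <= i')%N)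
      (m_ G i i')%:R * f i i'.
    rewrite -sumrMnl; apply: eq_bigr => i _.
    rewrite -sumrMnl; apply: eq_bigr => i' _.
    (* One doubling orients the edges of [H] here; the other is left for those of [G]. *)
    rewrite /f -(@sum_m_ _ H (q i i')) // mulrnAr; congr (_ *+ _).
    rewrite mulr_sumr; apply: eq_bigr => j _.
    by rewrite mulr_sumr; apply: eq_bigr => j' _; rewrite mulrA.
  rewrite sum_m_ // mulr2n -(sum_rel_prod (@adj G) (@adj H)).
  rewrite -big_split; apply: eq_bigr => g _.
  rewrite -big_split; apply: eq_bigr => g' _ /=.
  transitivity (\sum_(h : H) \sum_(h' | adj h h') E (g, h) (g', h') +
      \sum_(h : H) \sum_(h' | adj h h') E (g, h') (g', h)).
    rewrite -big_split; apply: eq_bigr => h _.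
    by rewrite -big_split; apply: eq_bigr => h' _; rewrite /q -!E_deg.
  (* Renaming [h] and [h'] turns the second sum into the first, since [adj] is symmetric. *)
  congr (_ + _); rewrite (exchange_big_dep xpredT) //=.
  by apply: eq_bigr => h _; apply: eq_bigl => h'; rewrite adj_sym.
apply: (@mulrn_mpoly_int_inj _ 2) => //=.
have M_2 : M_poly (disj_prod G H) *+ 2 =
    \sum_u \sum_(v | adj u.1 v.1 || adj u.2 v.2) E u v.
  apply: etrans (@sum_m_ _ (disj_prod G H) F F_sym); congr (_ *+ 2).
  apply: eq_bigr => i _; apply: eq_bigr => j le_ij.
  by rewrite /F (minn_idPl le_ij) (maxn_idPr le_ij).
rewrite mulrnBl mulrnDl S1_2 S2_2 S3_2 M_2 -big_split -sumrB.
by apply: eq_bigr => u _; rewrite sum_orb.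
Qed.
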